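(* Let $K$ be a class of Kripke frames closed under ultrapowers. Then $K$ is bi-intuitionistically definable if and only if $K$ is closed under generated subframes, bounded-morphic images and disjoint unions, and reflects prime-filter extensions.
   Context: **Language and semantics.** Let $\mathrm{Prop}$ be an arbitrary but fixed set of proposition letters. Bi-intuitionistic formulas over $\mathrm{Prop}$ are generated by $\phi ::= p\mid\top\mid\bot\mid\phi\wedge\phi\mid\phi\vee\phi\mid\phi\to\phi\mid\phi\prec\phi$ with $p\in\mathrm{Prop}$ ($\prec$ is co-implication). A Kripke frame is a poset $\mathfrak{F}=(W,\leq)$. A Kripke model $\mathfrak{M}=(\mathfrak{F},V)$ based on $\mathfrak{F}$ adds a valuation $V$ assigning to each $p\in\mathrm{Prop}$ an upset $V(p)$ of $(W,\leq)$. Truth at $w\in W$: $\mathfrak{M},w\Vdash p$ iff $w\in V(p)$; $\top$ is always true and $\bot$ never; $\wedge,\vee$ are interpreted pointwise as ''and'', ''or''; $\mathfrak{M},w\Vdash\phi\to\psi$ iff for all $v\in W$ with $w\leq v$, $\mathfrak{M},v\Vdash\phi$ implies $\mathfrak{M},v\Vdash\psi$; $\mathfrak{M},w\Vdash\phi\prec\psi$ iff there is $v\in W$ with $v\leq w$, $\mathfrak{M},v\Vdash\phi$ and not $\mathfrak{M},v\Vdash\psi$. A formula $\phi$ is valid on $\mathfrak{F}$ if $\mathfrak{M},w\Vdash\phi$ for every model $\mathfrak{M}$ based on $\mathfrak{F}$ and every $w\in W$. A class $K$ of Kripke frames is bi-intuitionistically definable if there is a set $\Theta$ of bi-intuitionistic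 formulas (over $\mathrm{Prop}$) such that $K$ is exactly the class of Kripke frames on which every formula of $\Theta$ is valid. **Frame constructions.** A bounded morphism from $(W,\leq)$ to $(W',\leq')$ is an order-preserving map $f:W\to W'$ such that for all $w\in W$, $u'\in W'$: (ub) if $f(w)\leq' u'$ then there is $u\in W$ with $w\leq u$ and $f(u)=u'$; (lb) if $u'\leq' f(w)$ then there is $u\in W$ with $u\leq w$ and $f(u)=u'$. If there is a surjective bounded morphism from $\mathfrak{F}$ to $\mathfrak{F}'$, then $\mathfrak{F}'$ is a bounded-morphic image of $\mathfrak{F}$. $\mathfrak{F}'$ is a generated subframe of $\mathfrak{F}$ if it is a substructure (subset with the induced order) of $\mathfrak{F}$ and the inclusion map is a bounded morphism. The disjoint union of a set of frames $(W_i,\leq_i)$, $i\in I$, is the disjoint union of the sets $W_i$ ordered by the disjoint union of the relations $\leq_i$. Ultrapowers of frames are ultrapowers of first-order structures with one binary relation. **Prime filter extension of a frame.** A filter of a lattice is a nonempty upset closed under $\wedge$; a filter $F$ is prime if it is proper and $x\vee y\in F$ implies $x\in F$ or $y\in F$. For a frame $\mathfrak{F}=(W,\leq)$, its prime filter extension $\mathfrak{pe}(\mathfrak{F})$ is the set of all prime filters of the lattice $\mathrm{Up}(W)$ of all upsets of $(W,\leq)$ (under $\cap,\cup$), ordered by inclusion. $K$ reflects prime-filter extensions if $\mathfrak{pe}(\mathfrak{F})\in K$ implies $\mathfrak{F}\in K$ for every Kripke frame $\mathfrak{F}$.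
   Formalization: The direction from the closure conditions to definability is stated only for an infinite set Prop of proposition letters; for each finite Prop it is false (n letters: take disjoint unions of chains with at most n+1 points). The other direction holds for every Prop. *)

(* Defs.v *)
From HB Require Import structures.
From mathcomp Require Import all_boot all_order.
From mathcomp Require Import all_classical.

Set Implicit Arguments.
Unset Strict Implicit.
Unset Printing Implicit Defensive.

Import Order.TTheory.

Local Open Scope order_scope.
Local Open Scope classical_set_scope.
Local Open Scope quotient_scope.

(* A Kripke frame is a [porderType d]; it may be empty.  The display [d] only
   controls notations: all frames of a class carry the same, arbitrary, one. *)

Section Upsets.
Context {d : Order.disp_t} (W : porderType d).

Definition upclosed : set (set W) :=
  [set A | forall x y : W, x <= y -> A x -> A y].

Definition up_pred : pred (set W) := fun A => `[< upclosed A >].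

Fact up_pred_meet_closed : meet_closed up_pred.
Proof.
move=> A B /asboolP upA /asboolP upB; apply/asboolP => x y xy [Ax Bx].
by split; [exact: upA xy Ax | exact: upB xy Bx].
Qed.

Fact up_pred_join_closed : join_closed up_pred.
Proof.
move=> A B /asboolP upA /asboolP upB; apply/asboolP => x y xy [Ax|Bx].
- by left; exact: upA xy Ax.
- by right; exact: upB xy Bx.
Qed.

HB.instance Definition _ :=
  Order.isLatticeClosed.Build set_display (set W) up_pred
    up_pred_meet_closed up_pred_join_closed.

(* The lattice Up(W), as a sublattice of the lattice of all subsets of W:
   the meet is the intersection and the join is the union. *)
Record upset := Upset { upset_set :> set W; upsetP : up_pred upset_set }.

HB.instance Definition _ := [isSub for upset_set].
HB.instance Definition _ := [Choice of upset by <:].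
HB.instance Definition _ := [SubChoice_isSubLattice of upset by <: with set_display].

End Upsets.

Section Language.

Inductive form (L : Type) : Type :=
| Var of L
| Top
| Bot
| And of form L & form L
| Or of form L & form L
| Imp of form L & form L
| Coimp of form L & form L.

Fixpoint forces {L : Type} {d : Order.disp_t} {W : porderType d}
    (V : L -> upset W) (w : W) (phi : form L) : Prop :=
  match phi with
  | Var p => (V p : set W) w
  | Top => True
  | Bot => False
  | And a b => forces V w a /\ forces V w b
  | Or a b => forces V w a \/ forces V w b
  | Imp a b => forall v : W, w <= v -> forces V v a -> forces V v b
  | Coimp a b => exists v : W, [/\ v <= w, forces V v a & ~ forces V v b]
  end.

Definition valid {L : Type} {d : Order.disp_t} (W : porderType d)
    (phi : form L) : Prop :=
  forall (V : L -> upset W) (w : W), forces V w phi.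

Definition definable (L : Type) {d : Order.disp_t}
    (K : porderType d -> Prop) : Prop :=
  exists Theta : set (form L),
    forall W : porderType d, K W <-> forall phi, Theta phi -> valid W phi.

End Language.

Record bounded_morphism {d d' : Order.disp_t} {W : porderType d}
    {W' : porderType d'} (f : W -> W') : Prop := BoundedMorphism {
  bm_homo : {homo f : x y / x <= y};
  bm_ub : forall (w : W) (u' : W'), f w <= u' ->
    exists2 u : W, w <= u & f u = u';
  bm_lb : forall (w : W) (u' : W'), u' <= f w ->
    exists2 u : W, u <= w & f u = u' }.

Section Subframe.
Context {d : Order.disp_t} {W : porderType d}.

Definition subframe (A : set W) : Type := {x : W | x \in A}.

HB.instance Definition _ (A : set W) := SubChoice.on (subframe A).
HB.instance Definition _ (A : set W) :=
  [SubChoice_isSubPOrder of subframe A by <: with d].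

Definition generated (A : set W) : Prop :=
  bounded_morphism (val : subframe A -> W).

End Subframe.

Section DisjointUnion.
Context {d : Order.disp_t} {I : Type} (W : I -> porderType d).

Definition disjoint_union : Type := {i : I & W i}.

Variant du_le_spec : disjoint_union -> disjoint_union -> Prop :=
  DuLe i (x y : W i) of x <= y : du_le_spec (existT _ i x) (existT _ i y).

Definition du_le (u v : disjoint_union) : bool := `[< du_le_spec u v >].

Lemma du_leP (u v : disjoint_union) :
  reflect (exists e : tag v = tag u,
             tagged u <= ecast i (W i) e (tagged v)) (du_le u v).
Proof.
apply: (iffP (asboolP _)) => [[i x y xy]|]; first by exists erefl.
case: u v => [i x] [j y] /= [e]; case: _ / e x => x /= xy; exact: DuLe.
Qed.

Fact du_le_refl : reflexive du_le.
Proof. by case=> i x; apply/asboolP; exact: DuLe. Qed.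

Fact du_le_anti : antisymmetric du_le.
Proof.
move=> u v /andP[/asboolP[i x y xy] /du_leP[/= e]].
rewrite (Prop_irrelevance e erefl) /= => yx.
by congr existT; apply/le_anti; rewrite xy yx.
Qed.

Fact du_le_trans : transitive du_le.
Proof.
move=> v u w /asboolP[i x y xy] /du_leP[]; case: w => j z /= e.
case: _ / e x y xy => x y xy /= yz.
by apply/asboolP; apply: DuLe; exact: le_trans xy yz.
Qed.

HB.instance Definition _ := gen_eqMixin disjoint_union.
HB.instance Definition _ := gen_choiceMixin disjoint_union.
HB.instance Definition _ := Order.Le_isPOrder.Build d disjoint_union
  du_le_refl du_le_anti du_le_trans.

End DisjointUnion.

Section Ultrapower.
Context {d : Order.disp_t} {I : Type} (U : set_system I) {FU : UltraFilter U}.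
Variable W : porderType d.

Definition ae_eq (f g : I -> W) : bool := `[< U [set i | f i = g i] >].
Definition ae_le (f g : I -> W) : bool := `[< U [set i | f i <= g i] >].

Fact ae_eq_refl : reflexive ae_eq.
Proof. by move=> f; apply/asboolP; apply: filterE. Qed.

Fact ae_eq_sym : symmetric ae_eq.
Proof. by move=> f g; apply/asboolP/asboolP; apply: filterS => i /= ->. Qed.

Fact ae_eq_trans : transitive ae_eq.
Proof.
move=> g f h /asboolP fg /asboolP gh; apply/asboolP.
by apply: filterS2 fg gh => i /= ->.
Qed.

Canonical ae_eq_equiv := EquivRel ae_eq ae_eq_refl ae_eq_sym ae_eq_trans.

Definition ultrapower : Type := {eq_quot ae_eq_equiv}.

HB.instance Definition _ := Choice.on ultrapower.
HB.instance Definition _ := EqQuotient.on ultrapower.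

Definition ultrapower_le (x y : ultrapower) : bool := ae_le (repr x) (repr y).

Lemma ultrapower_leE (f g : I -> W) :
  ultrapower_le (\pi_ultrapower f) (\pi_ultrapower g) = ae_le f g.
Proof.
have reprE (h : I -> W) : U [set i | repr (\pi_ultrapower h) i = h i].
  apply/asboolP; rewrite -/(ae_eq _ _) -[ae_eq _ _]/(ae_eq_equiv _ _).
  by apply/eqmodP; rewrite reprK.
by apply/asboolP/asboolP => le_fg;
  apply: filterS3 (reprE f) (reprE g) le_fg => i /= -> ->.
Qed.

Fact ultrapower_le_refl : reflexive ultrapower_le.
Proof. by move=> x; apply/asboolP; apply: filterE => i /=. Qed.

Fact ultrapower_le_anti : antisymmetric ultrapower_le.
Proof.
move=> x y /andP[/asboolP xy /asboolP yx].
rewrite -[x]reprK -[y]reprK; apply/eqmodP/asboolP.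
by apply: filterS2 xy yx => i /= xy yx; apply/le_anti; rewrite xy yx.
Qed.

Fact ultrapower_le_trans : transitive ultrapower_le.
Proof.
move=> y x z /asboolP xy /asboolP yz; apply/asboolP.
by apply: filterS2 xy yz => i /=; exact: le_trans.
Qed.

HB.instance Definition _ := Order.Le_isPOrder.Build d ultrapower
  ultrapower_le_refl ultrapower_le_anti ultrapower_le_trans.

End Ultrapower.
Arguments ultrapower {d I} U {FU} W.

Section PrimeFilterExtension.

Definition lattice_filter {d : Order.disp_t} {T : latticeType d}
    (F : set T) : Prop :=
  [/\ F !=set0,
      (forall x y : T, x <= y -> F x -> F y) &
      (forall x y : T, F x -> F y -> F (Order.meet x y))].

Definition prime_filter {d : Order.disp_t} {T : latticeType d}
    (F : set T) : Prop :=
  [/\ lattice_filter F, F <> setT &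
      (forall x y : T, F (Order.join x y) -> F x \/ F y)].

Context {d : Order.disp_t} (W : porderType d).

Definition pe : Type := {F : set (upset W) | `[< prime_filter F >]}.

HB.instance Definition _ := SubChoice.on pe.
(* The order of [set (upset W)] is inclusion. *)
HB.instance Definition _ := [SubChoice_isSubPOrder of pe by <: with d].

End PrimeFilterExtension.

Section Closure.
Context {d : Order.disp_t} (K : porderType d -> Prop).

Definition closed_generated_subframes : Prop :=
  forall (W : porderType d) (A : set W),
    K W -> generated A -> K (subframe A).

Definition closed_bounded_morphic_images : Prop :=
  forall (W W' : porderType d) (f : W -> W'),
    K W -> bounded_morphism f -> (forall y, exists x, f x = y) -> K W'.

(* The index type may be empty, the disjoint union then being the empty
   frame. *)
Definition closed_disjoint_unions : Prop :=
  forall (I : Type) (W : I -> porderType d),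
    (forall i, K (W i)) -> K (disjoint_union W).

Definition closed_ultrapowers : Prop :=
  forall (I : Type) (U : set_system I) (FU : UltraFilter U)
    (W : porderType d), K W -> K (ultrapower U W).

Definition reflects_pe : Prop :=
  forall W : porderType d, K (pe W) -> K W.

End Closure.

(* Main.v *)
Require Import Defs.
From mathcomp Require Import all_boot all_order.
From mathcomp Require Import all_classical wochoice.

(* Definability gives the closure conditions because validity transfers along
   the four constructions; for reflection, a formula holds at a prime filter
   of upsets iff its truth set belongs to it.

   Conversely, let W validate every formula valid on K.  Take the upsets of W
   as letters (a formula has finitely many, so they can be renamed into the
   infinite set L) and let F be a disjoint union of frames of K refuting every
   formula that K refutes.  In an ultrapower of F, the points x whose theory
   respects the inclusions between truth sets in W form a generated subframe,
   and x |-> {a | x satisfies the letter a} is a bounded morphism from it onto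
   pe W, so that pe W, hence W, is in K.

   The back conditions require realizing types over as many formulas as W has
   upsets with an arbitrary point of the ultrapower as a parameter, hence a good
   ultrafilter; it is obtained by Kunen's transfinite construction from a large
   independent family of functions. *)

Set Implicit Arguments.
Unset Strict Implicit.
Unset Printing Implicit Defensive.

Import Order.TTheory.

Local Open Scope order_scope.
Local Open Scope classical_set_scope.
Local Open Scope quotient_scope.

(** * Good ultrafilters *)

(** If [T] injects into a proper initial segment of a well-order, take the least such [t] and pull
    the order back along the injection [j]: a large segment of the new order would give one below
    some [j u], against minimality. *)
Lemma well_order_small_segments (T : eqType) :
  exists R : T -> T -> Prop,
    [/\ forall P : set T, P !=set0 -> exists2 z, P z & forall x, P x -> R z x,
        forall x y, R x y -> R y x -> x = y &
        forall t, ~ exists2 j : T -> T, injective j &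
                      forall x, R (j x) t /\ j x <> t].
Proof.
have [R0 wo] := well_ordering_principle T.
have minR (P : set T) : P !=set0 -> exists2 z, P z & forall x, P x -> R0 z x.
  move=> [x Px]; have [|z [[]]] := wo (fun y => `[< P y >]).
    by exists x; exact/asboolP.
  by move=> /asboolP Pz zmin _; exists z => // y Py; exact/zmin/asboolP.
have antiR x y : R0 x y -> R0 y x -> x = y.
  move=> xy yx; have [|z [_ uz]] := wo (pred2 x y).
    by exists x; rewrite inE eqxx.
  have Rrefl u : R0 u u.
    by have [|_ -> /(_ u erefl)] := minR [set u]; first by exists u.
  have mem u : u \in pred2 x y -> R0 u x -> R0 u y -> z = u.
    by move=> uin ux uy; apply: uz; split=> // v; rewrite inE => /orP[]/eqP->.
  have zx : z = x by apply: mem; rewrite ?inE ?eqxx.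
  have zy : z = y by apply: mem; rewrite ?inE ?eqxx ?orbT.
  by rewrite -zx.
pose small R := forall t : T, ~ exists2 j : T -> T, injective j &
                      forall x, R (j x) t /\ j x <> t.
have [|nsmall] := pselect (small R0); first by exists R0; split.
have /minR[t [j jinj jt] tmin] : [set t | exists2 j : T -> T, injective j &
    forall x, R0 (j x) t /\ j x <> t] !=set0.
  apply: contrapT => no; apply: nsmall => t jt; apply: no; by exists t.
exists (fun x y => R0 (j x) (j y)); split.
- move=> P [x Px]; have [|_ [y Py <-] ymin] := minR (j @` P).
    by exists (j x), x.
  by exists y => // z Pz; apply: ymin; exists z.
- by move=> x y xy yx; apply/jinj/antiR.
- move=> u [k kinj ku]; have [jut] := jt u; apply.
  apply: antiR => //; apply: tmin; exists (j \o k); first exact: inj_comp.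
  by move=> x; have [? ne] := ku x; split=> //= /jinj.
Qed.

Section GoodUltrafilter.
Variable A : choiceType.

(* Trees over [A] absorb pairs and lists, so that both the independent
   functions and the tasks of the construction, i.e. the families
   [seq A -> set gidx], can be indexed by the same type [key]. *)
Local Notation tree := (GenTree.tree A).
Local Notation key := (set tree).
Definition gidx : Type := (seq tree * seq (seq tree * seq A))%type.

(* Hausdorff's independent family: [i.2] is the graph of a finite function on
   the traces of keys on the finite set [i.1]. *)
Definition indep_fun (B : key) (i : gidx) : seq A :=
  xget [::] [set v | ([seq k <- i.1 | `[< B k >]], v) \in i.2].

Definition functional (c : seq (key * seq A)) : Prop :=
  {in c &, forall b b', b.1 = b'.1 -> b = b'}.

Definition matches (c : seq (key * seq A)) : set gidx :=
  [set i | {in c, forall b, indep_fun b.1 i = b.2}].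

(** Distinct keys occurring in [c] are separated by a finite set of trees, so their traces on it
    differ and the prescribed values form the graph of a function. *)
Lemma indep_funP c : functional c -> matches c !=set0.
Proof.
move=> fc.
have /choice[sep sepP] (BB : key * key) :
    exists k, BB.1 <> BB.2 -> ~ (BB.1 k <-> BB.2 k).
  apply: contrapT => /forallNP no; apply: (no (GenTree.Node 0 [::])) => ne _.
  apply: ne; apply/seteqP; split=> k;
    by have /not_implyP[_ /contrapT[]] := no k.
pose s := [seq sep (b.1, b'.1) | b <- c, b' <- c].
pose fil (B : key) := [seq k <- s | `[< B k >]].
have filP b b' : b \in c -> b' \in c -> fil b.1 = fil b'.1 -> b.1 = b'.1.
  move=> bc b'c /(congr1 (fun l => sep (b.1, b'.1) \in l)).
  have sin : sep (b.1, b'.1) \in s by apply: allpairs_f.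
  rewrite !mem_filter sin !andbT => eqb; apply: contrapT => ne.
  apply: (sepP (b.1, b'.1) ne) => /=.
  by split=> /asboolP; [rewrite eqb | rewrite -eqb] => /asboolP.
exists (s, [seq (fil b.1, b.2) | b <- c]) => b bc; rewrite /indep_fun /=.
apply: xget_subset1; first by rewrite /= -/(fil b.1); apply/mapP; exists b.
move=> v v' /= /mapP[b1 b1c [/(filP _ _ bc b1c) e1 ->]].
move=> /mapP[b2 b2c [/(filP _ _ bc b2c) e2 ->]].
by rewrite (fc b1 b2) // -e1.
Qed.

Definition gcode (u : seq A * gidx) : tree :=
  let leaves v := GenTree.Node 0 [seq GenTree.Leaf a | a <- v] in
  GenTree.Node 0 [:: leaves u.1; GenTree.Node 0 u.2.1;
    GenTree.Node 0 [seq GenTree.Node 0 [:: GenTree.Node 0 b.1; leaves b.2]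
                   | b <- u.2.2]].

Lemma gcode_inj : injective gcode.
Proof.
have leafI : injective (map (@GenTree.Leaf A)) by apply: inj_map => x y [].
move=> [v [s r]] [v' [s' r']] [] /leafI -> -> /inj_map -> //.
by move=> [x y] [x' y'] [] /= -> /leafI ->.
Qed.

Definition task (t : key) (s : seq A) : set gidx := [set i | t (gcode (s, i))].

Lemma task_surj (p : seq A -> set gidx) : exists t, task t = p.
Proof.
exists (gcode @` [set u | p u.1 u.2]); apply/funext => s; apply/seteqP.
split=> [i [[s' i'] ? /gcode_inj[<- <-]]//|i psi].
by exists (s, i).
Qed.

(* Konig's inequality: [set tree] is equinumerous with its countable power. *)
Lemma key_koenig (S : set key) (h : key -> key * nat) : injective h ->
  (forall B, S (h B).1) ->
  exists2 j : key -> key, injective j & forall B, S (j B).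
Proof.
(* A key is read as the sequence of its rows. If the keys indexed [n] by [h] realize every possible
   [n]-th row, choosing one for each row gives the injection. *)
move=> hinj hS; pose row n (B : key) : key := [set k | B (GenTree.Node n [:: k])].
have [[n nsurj]|nsurj] := pselect (exists n, forall X, exists B,
    (h B).2 = n /\ row n B = X).
  have [g gP] := choice nsurj; exists (fun X => (h (g X)).1) => // X Y eq1.
  have [hX <-] := gP X; have [hY <-] := gP Y; congr row; apply: hinj.
  by rewrite [h (g X)]surjective_pairing hX eq1 -hY -surjective_pairing.
(* Otherwise each [n] misses some row [X n]; the key with all these rows contradicts this at its own
   index. *)
have /choice[X XP] n : exists X, forall B, (h B).2 = n -> row n B <> X.
  apply: contrapT => /forallNP no; apply: nsurj; exists n => X.
  apply: contrapT => /forallNP no'; apply: (no X) => B hB rB.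
  by apply: (no' B).
pose B0 : key := [set t | exists n k, t = GenTree.Node n [:: k] /\ X n k].
case: (XP (h B0).2 B0) => //; apply/seteqP; split=> k /=.
  by move=> [n [k' [[-> ->]]]].
by move=> ?; exists (h B0).2, k.
Qed.

(* A stage of the construction is encoded as a single set of atoms, so that the
   limit of a chain of stages is its union.  An atom is a task already handled,
   a generator of the filter, or a triple [(t, n, B)] recording that [B] is the
   [n]-th independent function used up by the task [t]. *)
Definition atom : Type := (key + set gidx + key * nat * key)%type.

Definition handled_tasks (Z : set atom) : set key := [set t | Z (inl (inl t))].
Definition gens (Z : set atom) : set (set gidx) := [set X | Z (inl (inr X))].
Definition reserved (Z : set atom) : set key :=
  [set B | exists t n, Z (inr (t, n, B))].

(** The filter generated by [D], possibly improper. *)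
Definition below (D : set (set gidx)) : set (set gidx) :=
  [set X | exists2 l : seq (set gidx), {in l, forall Y, D Y} &
             forall i, {in l, forall Y, Y i} -> X i].

Definition independent (D : set (set gidx)) (used : set key) : Prop :=
  forall c X, functional c -> {in c, forall b, ~ used b.1} -> below D X ->
    (X `&` matches c) !=set0.

Definition refined (B t : key) (s : seq A) : set gidx :=
  [set i | {subset s <= indep_fun B i} /\ task t (indep_fun B i) i].

(** Either no proper filter containing [D] contains all the sets [task t s], or [indep_fun B] is a
    choice as goodness requires; both persist when [D] grows. *)
Definition handled (D : set (set gidx)) (t : key) : Prop :=
  (exists s, below D (~` task t s)) \/ (exists B, forall s, below D (refined B t s)).

Lemma below_gen D X : D X -> below D X.
Proof.
move=> DX; exists [:: X] => [Y|i /(_ X)]; first by rewrite inE => /eqP ->.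
by rewrite inE eqxx; exact.
Qed.

Lemma below_sub D D' : D `<=` D' -> below D `<=` below D'.
Proof. by move=> DD' X [l lD lX]; exists l => // Y /lD/DD'. Qed.

Lemma below_filter D : Filter (below D).
Proof.
split; first by exists [::].
  move=> X Y [l lD lX] [m mD mY]; exists (l ++ m).
    by move=> Z; rewrite mem_cat => /orP[/lD|/mD].
  by move=> i H; split; [apply: lX|apply: mY] => Z Zin; apply: H;
     rewrite mem_cat Zin ?orbT.
by move=> X Y XY [l lD lX]; exists l => // i /lX/XY.
Qed.

Lemma handled_sub D D' : D `<=` D' -> handled D `<=` handled D'.
Proof.
move=> /below_sub DD' t [[s /DD' ?]|[B DB]]; first by left; exists s.
by right; exists B => s; exact: DD'.
Qed.

(* Kunen's induction step.  Either some [task t s] can be excluded by fixing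
   the values of finitely many unused independent functions, or else the sets
   [refined B t s] can be added for any unused [B]. *)
Lemma kunen_step D used t B : independent D used -> ~ used B ->
  exists G (k : seq key),
    independent (D `|` G) (used `|` [set` k]) /\ handled (D `|` G) t.
Proof.
move=> indD uB; have FD := below_filter D.
have [[s [c [fc uc nt]]]|no] := pselect (exists s c, [/\ functional c,
    {in c, forall b, ~ used b.1} & below D (~` (task t s `&` matches c))]).
- exists [set matches c], [seq b.1 | b <- c]; split; last first.
    left; exists s; have FD' := below_filter (D `|` [set matches c]).
    have : below (D `|` [set matches c]) (matches c) by apply: below_gen; right.
    apply: filterS2 (below_sub (@subsetUl _ _ _) nt) => i nti mi ti.
    exact: nti.
  (* The new generator relativizes membership in the filter to [matches c], so that it suffices to
     prepend [c] to [c']. *)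
  have sub X : below (D `|` [set matches c]) X -> below D (X `|` ~` matches c).
    move=> [l lD lX]; exists [seq Y <- l | `[< D Y >]].
      by move=> Y; rewrite mem_filter => /andP[/asboolP].
    move=> i li; have [mi|] := pselect (matches c i); last by right.
    left; apply: lX => Y Yl; have [DY|->//] := lD Y Yl.
    by apply: li; rewrite mem_filter Yl andbT; apply/asboolP.
  move=> c' X fc' uc' /sub DX; have [||i [Xi mi]] := indD (c ++ c') _ _ _ DX.
  + have disj b b' : b \in c -> b' \in c' -> b.1 <> b'.1.
      move=> bc /uc' nb e; apply: nb; right => /=; rewrite -e; exact: map_f.
    move=> b b'; rewrite !mem_cat => /orP[] bc /orP[] b'c.
    * exact: fc.
    * by move=> /(disj _ _ bc b'c).
    * by move=> /esym/(disj _ _ b'c bc).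
    * exact: fc'.
  + move=> b; rewrite mem_cat => /orP[/uc//|/uc' ub ?]; by apply: ub; left.
  + have mc : matches c i by move=> b bc; apply: mi; rewrite mem_cat bc.
    exists i; split; first by case: Xi.
    by move=> b bc; apply: mi; rewrite mem_cat bc orbT.
- exists (range (refined B t)), [:: B]; split; last first.
    by right; exists B => s; apply: below_gen; right; exists s.
  (* Finitely many sets [refined B t s] all contain the one for the concatenated list. *)
  have sub X : below (D `|` range (refined B t)) X ->
      exists s, below D (X `|` ~` refined B t s).
    move=> [l lD lX].
    suff [s sP] : exists s, below D ([set i | {in l, forall Y, Y i}] `|`
                                     ~` refined B t s).
      exists s; apply: filterS sP => i [/lX|?]; by [left|right].
    elim: l {X lX} lD => [_|Y l IHl lD].
      by exists [::]; apply: filterE => i; left.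
    have [|s sP] := IHl; first by move=> Z Zl; apply: lD; rewrite inE Zl orbT.
    have [DY|[s' _ Ys']] := lD Y (mem_head _ _).
    + exists s; move: sP; apply: filterS2 (below_gen DY) => i Yi [li|]; last by right.
      by left=> Z; rewrite inE => /orP[/eqP->|/li].
    + exists (s' ++ s); apply: filterS sP => i Hi.
      have [[ss ti]|] := pselect (refined B t (s' ++ s) i); last by right.
      left=> Z; rewrite inE => /orP[/eqP->|Zl].
        by rewrite -Ys'; split=> // a as'; apply: ss; rewrite mem_cat as'.
      case: Hi => [/(_ _ Zl)//|[]]; split=> // a as'.
      by apply: ss; rewrite mem_cat as' orbT.
  (* If [X] missed [matches c'], prescribing the value [s] for [B] besides [c'] would exclude
     [task t s], which is the first case. *)
  move=> c' X fc' uc' /sub[s DX]; apply: contrapT => nX; apply: no.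
  have uc1 b : b \in c' -> b.1 <> B.
    by move=> /uc' ub e; apply: ub; right; rewrite /= inE e.
  exists s, ((B, s) :: c'); split.
  + move=> b b'; rewrite !inE => /orP[/eqP->|bc'] /orP[/eqP->|b'c'] //=.
    * by move=> /esym/(uc1 _ b'c').
    * by move=> /(uc1 _ bc').
    * exact: fc'.
  + move=> b; rewrite inE => /orP[/eqP->//|/uc' ub ?]; by apply: ub; left.
  + apply: filterS DX => i Xi [ti mi]; apply: nX; exists i; split.
      have fB : indep_fun B i = s by rewrite (mi (B, s)) // inE eqxx.
      by case: Xi => [//|[]]; rewrite /refined /= fB; split.
    by move=> b bc'; apply: mi; rewrite inE bc' orbT.
Qed.

(** Zorn's lemma on stages. If a maximal stage left a least task [t] unhandled, the earlier tasks
    would be too few to have reserved every key, and Kunen's step with a free key would extend the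
    stage. *)
Lemma good_generators : exists D : set (set gidx),
  (forall X, below D X -> X !=set0) /\ forall t, handled D t.
(* The first three clauses of [inv] bound the reserved keys by countably many for each task of an
   initial segment. *)
Proof.
have [R [Rmin Ranti Rsmall]] := well_order_small_segments key.
pose inv (Z : set atom) := [/\
  forall x y, handled_tasks Z x -> R y x -> handled_tasks Z y,
  forall t n B B', Z (inr (t, n, B)) -> Z (inr (t, n, B')) -> B = B',
  forall t n B, Z (inr (t, n, B)) -> handled_tasks Z t,
  independent (gens Z) (reserved Z) &
  handled_tasks Z `<=` handled (gens Z)].
have [F Finv totF|Z [[Zini Zfun Zst Zind Zhan] Zmax]] := @Zorn_bigcup atom inv.
  set Z := \bigcup_(X in F) X.
  have subZ Y : F Y -> Y `<=` Z by move=> FY x Yx; exists Y.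
  split.
  - move=> x y [Y FY Yx] xy; apply: (subZ Y) => //.
    by have [ini _ _ _ _] := Finv Y FY; exact: ini xy.
  - move=> t n B B' [Y FY YB] [Y' FY' YB'].
    have [sub|sub] := totF _ _ FY FY'.
      by have [_ + _ _ _] := Finv Y' FY'; apply; [apply: sub; exact: YB|].
    by have [_ + _ _ _] := Finv Y FY; apply; [exact: YB|apply: sub; exact: YB'].
  - move=> t n B [Y FY YB]; apply: (subZ Y) => //.
    by have [_ _ + _ _] := Finv Y FY; apply; exact: YB.
  - move=> c X fc uc [l lZ lX].
    (* The empty chain has no generators; otherwise the finitely many generators involved lie in one
       stage. *)
    have [[Y0 FY0]|F0] := pselect (F !=set0); last first.
      have l0 : l = [::].
        by case: l lZ {lX} => // Y l /(_ Y (mem_head _ _))[Y0 ?]; case: F0; exists Y0.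
      have [i mi] := indep_funP fc; exists i; split=> //; apply: lX.
      by rewrite l0.
    suff [Y FY lY] : exists2 Y, F Y & {in l, forall G, gens Y G}.
      have [_ _ _ ind _] := Finv Y FY; apply: ind => //; last by exists l.
      by move=> b bc [t [n Yb]]; apply: (uc b bc); exists t, n; exact: subZ Yb.
    elim: l lZ {lX} => [_|G l IHl lZ]; first by exists Y0.
    have [|Y FY lY] := IHl; first by move=> H Hl; apply: lZ; rewrite inE Hl orbT.
    have [Y' FY' Y'G] := lZ G (mem_head _ _).
    have [sub|sub] := totF _ _ FY FY'.
      by exists Y' => // H; rewrite inE => /orP[/eqP->//|/lY/sub].
    by exists Y => // H; rewrite inE => /orP[/eqP->|/lY//]; exact: sub.
  - move=> t [Y FY Yt]; have [_ _ _ _ han] := Finv Y FY.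
    by apply: handled_sub (han _ Yt) => G; exact: subZ.
exists (gens Z); split.
  move=> X DX.
  have f0 : functional [::] by [].
  have [//|i [Xi _]] := Zind [::] X f0 _ DX; by exists i.
move=> t0; apply: (Zhan); apply: contrapT => nt0.
have [|t nt tmin] := Rmin (~` handled_tasks Z); first by exists t0.
have stlt x : handled_tasks Z x -> R x t /\ x <> t.
  move=> Zx; have xt : x <> t by move=> e; apply: nt; rewrite -e.
  split=> //; have [|z [->|->]] := Rmin [set x; t]; first by exists x; left.
    by apply; right.
  by move=> /(_ x (or_introl erefl)) /(Zini _ _ Zx) /nt.
have [B nB] : exists B, ~ reserved Z B.
  apply: contrapT => /forallNP allB.
  have /choice[h hP] B : exists u : key * nat, Z (inr (u.1, u.2, B)).
    by have /contrapT[t' [n ZB]] := allB B; exists (t', n).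
  have [|B|j jinj jst] := @key_koenig (handled_tasks Z) h.
  - move=> B B' e; have := hP B; have := hP B'; rewrite e => ZB ZB'.
    exact: Zfun ZB' ZB.
  - exact: Zst (hP B).
  - by apply: (Rsmall t); exists j => // x; exact: stlt.
have [G [k [ind han]]] := kunen_step t Zind nB.
pose Z' : set atom := Z `|` [set x | match x with
  | inl (inl t') => t' = t
  | inl (inr X) => G X
  | inr (t', n, B) => [/\ t' = t, (n < size k)%N & B = nth B k n]
  end].
apply: (Zmax Z').
  split; first by move=> x; left.
  by move=> /(_ (inl (inl t))) sub; apply/nt/sub; right.
have gZ' : gens Z' = gens Z `|` G by [].
have rZ' : reserved Z `|` [set` k] `<=` reserved Z'.
  move=> B' [[t' [n ZB]]|kB]; first by exists t', n; left.
  by exists t, (index B' k); right; rewrite /= index_mem nth_index.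
split.
- move=> x y [Zx|->] yx; first by left; exact: Zini yx.
  have [Zy|nZy] := pselect (handled_tasks Z y); first by left.
  by right; apply: Ranti yx _; exact: tmin.
- move=> t' n B1 B2 [ZB|[/= et nk eB]] [ZB'|[/= et' _ eB']].
  + exact: Zfun ZB ZB'.
  + by case: nt; rewrite -et'; exact: Zst ZB.
  + by case: nt; rewrite -et; exact: Zst ZB'.
  + by rewrite eB eB'; exact: set_nth_default.
- by move=> t' n B1 [/Zst|[-> _ _]]; [left|right].
- by move=> c X fc uc; rewrite gZ'; apply: ind => // b bc /rZ'; exact: uc.
- by move=> t' [/Zhan|->]; rewrite gZ' //; apply: handled_sub; exact: subsetUl.
Qed.

(** An ultrafilter extending the filter of [good_generators] contains no complement of a set [p s],
    so the task coding [p] is handled by an independent function. *)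
Lemma good_ultrafilter : exists U : set_system gidx, UltraFilter U /\
  forall p : seq A -> set gidx, (forall s : seq A, U (p s)) ->
    exists g : gidx -> seq A,
      forall s : seq A, U [set i | {subset s <= g i} /\ p (g i) i].
Proof.
have [D [D0 Dhan]] := good_generators.
have [|U [UU DU]] := @ultraFilterLemma _ (below D).
  exact: Build_ProperFilter_ex D0 (below_filter D).
exists U; split=> // p Up; have [t tp] := task_surj p.
have [[s /DU]|[B DB]] := Dhan t.
  move=> nts; exfalso; apply: (@filter_not_empty _ U).
  by apply: filterS2 (Up s) nts => i; rewrite tp.
by exists (indep_fun B) => s; have /DU := DB s; rewrite /refined tp.
Qed.

End GoodUltrafilter.

(** * Validity and frame constructions *)

Section TruthSets.
Context {d : Order.disp_t} {W : porderType d}.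
Implicit Types a b : upset W.

Definition mk_upset (A : set W) (upA : upclosed A) : upset W :=
  Upset (introT (asboolP _) upA).

Lemma upset_up a : upclosed a.
Proof. by case: a => A /= /asboolP. Qed.

Lemma le_upset a b : (a <= b) = ((a : set W) `<=` b) :> Prop.
Proof. by rewrite -Order.le_val subsetEset. Qed.

Lemma forces_up (L : Type) (V : L -> upset W) (phi : form L) :
  upclosed [set w | forces V w phi].
Proof.
elim: phi => //= [p|a IHa b IHb|a IHa b IHb|a IHa b IHb|a IHa b IHb] v w vw.
- exact: upset_up vw.
- by move=> [/(IHa _ _ vw) ? /(IHb _ _ vw)].
- by move=> [/(IHa _ _ vw)|/(IHb _ _ vw)]; [left|right].
- by move=> ab u wu; apply: ab; exact: le_trans wu.
- by move=> [u [uv ua ub]]; exists u; split=> //; exact: le_trans vw.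
Qed.

Definition truth_set (L : Type) (V : L -> upset W) (phi : form L) : upset W :=
  mk_upset (@forces_up L V phi).

Lemma truth_var (L : Type) (V : L -> upset W) p : truth_set V (Var p) = V p.
Proof. exact: val_inj. Qed.

End TruthSets.

Lemma forces_bounded_morphism (L : Type) (d d' : Order.disp_t)
    (W : porderType d) (W' : porderType d') (f : W -> W')
    (V : L -> upset W) (V' : L -> upset W') :
  bounded_morphism f -> (forall p w, (V p : set W) w <-> (V' p : set W') (f w)) ->
  forall phi w, forces V w phi <-> forces V' (f w) phi.
Proof.
move=> bf VV'; elim=> //= [a IHa b IHb|a IHa b IHb|a IHa b IHb|a IHa b IHb] w.
- by rewrite IHa IHb.
- by rewrite IHa IHb.
- split=> ab u wu.
    have [v wv <-] := bm_ub bf wu.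
    by move=> /IHa/(ab _ wv)/IHb.
  by move=> /IHa/(ab _ (bm_homo bf wu))/IHb.
- split=> [[v [vw va vb]]|[u [uw ua ub]]].
    by exists (f v); split; [exact: (bm_homo bf)|exact/IHa|move=> /IHb].
  have [v vw fv] := bm_lb bf uw; exists v; split=> //.
    by apply/IHa; rewrite fv.
  by move=> /IHb; rewrite fv.
Qed.

Section ValidityPreservation.
Context {L : Type} {d : Order.disp_t}.
Implicit Types (W : porderType d) (phi : form L).

Lemma valid_image W W' (f : W -> W') phi :
  bounded_morphism f -> (forall y, exists x, f x = y) -> valid W phi -> valid W' phi.
Proof.
move=> bf fsurj Wphi V' y; have [x <-] := fsurj y.
have up p : upclosed (f @^-1` V' p).
  by move=> u v uv; apply: upset_up; exact: (bm_homo bf).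
by apply/(forces_bounded_morphism (V := fun p => mk_upset (@up p)) bf).
Qed.

Lemma valid_generated W (A : set W) phi : generated A -> valid W phi ->
  valid (subframe A) phi.
Proof.
move=> gA Wphi V x.
have up p : upclosed ((val : subframe A -> W) @` V p).
  move=> w v + [u Vu uw]; rewrite -{w}uw => uv; have [u' uu' <-] := bm_ub gA uv.
  by exists u' => //; exact: upset_up Vu.
apply/(forces_bounded_morphism (V' := fun p => mk_upset (@up p)) gA) => //.
by move=> p w; split=> [|[v Vv /val_inj <-//]]; exists w.
Qed.

Lemma disjoint_union_inj (I : Type) (W : I -> porderType d) i :
  bounded_morphism (fun x : W i => existT _ i x : disjoint_union W).
Proof.
have leE j (x y : W j) : (existT _ j x : disjoint_union W) <= existT _ j y -> x <= y.
  by move=> /du_leP[/= e]; rewrite (Prop_irrelevance e erefl).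
split.
- by move=> x y xy; apply/asboolP; exact: DuLe.
- move=> x [j y] xy; have [/= e _] := du_leP _ _ xy.
  by case: _ / e x xy => x xy; exists y => //; exact: leE.
- move=> x [j y] yx; have [/= e _] := du_leP _ _ yx.
  by case: _ / e y yx => y yx; exists y => //; exact: leE.
Qed.

Lemma valid_disjoint_union (I : Type) (W : I -> porderType d) phi :
  (forall i, valid (W i) phi) -> valid (disjoint_union W) phi.
Proof.
move=> Wphi V [i x].
have up p : upclosed [set y : W i | (V p : set (disjoint_union W)) (existT _ i y)].
  by move=> y z yz; apply: upset_up; exact: (bm_homo (disjoint_union_inj W i)).
apply/(forces_bounded_morphism (V := fun p => mk_upset (@up p))
  (disjoint_union_inj W i)) => //.
exact: Wphi.
Qed.

End ValidityPreservation.

(** * Prime filter extensions *)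

Section PrimeFilters.
Context {d : Order.disp_t} {W : porderType d}.
Implicit Types (P Q : pe W) (a b : upset W).

Definition bot_upset : upset W := @mk_upset d W set0 (fun _ _ _ => id).

Definition mk_pe (F : set (upset W)) (primeF : prime_filter F) : pe W :=
  exist (fun F => `[< prime_filter F >]) F (introT (asboolP _) primeF).

Lemma pe_prime P : prime_filter (val P).
Proof. exact/asboolP/(valP P). Qed.

Lemma pe_sub P a b : (a : set W) `<=` b -> val P a -> val P b.
Proof.
by have [[_ up _] _ _] := pe_prime P => ab; apply: up; rewrite le_upset.
Qed.

Lemma pe_meet P a b (c : upset W) :
  val P a -> val P b -> (a : set W) `&` b `<=` c -> val P c.
Proof.
have [[_ _ meetP] _ _] := pe_prime P => Pa Pb abc.
by apply: (@pe_sub _ (Order.meet a b)) => //; exact: meetP.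
Qed.

Lemma pe_join P a b (c : upset W) :
  val P c -> (c : set W) `<=` (a : set W) `|` b -> val P a \/ val P b.
Proof.
have [_ _ joinP] := pe_prime P => Pc cab; apply: joinP; exact: pe_sub Pc.
Qed.

Lemma pe_top P a : setT `<=` (a : set W) -> val P a.
Proof.
have [[[b Pb] _ _] _ _] := pe_prime P => Ta.
by apply: pe_sub Pb => x _; exact: Ta.
Qed.

Lemma pe_bot P a : (a : set W) `<=` set0 -> ~ val P a.
Proof.
have [_ PT _] := pe_prime P => a0 Pa; apply: PT; apply/seteqP; split=> // b _.
by apply: pe_sub Pa => x /a0.
Qed.

Lemma le_pe P Q : (P <= Q) = (val P `<=` val Q) :> Prop.
Proof. by rewrite -Order.le_val subsetEset. Qed.

Lemma ultrafilter_trace (U : set_system W) : UltraFilter U ->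
  prime_filter [set a : upset W | U a].
Proof.
move=> UU; split; first split.
- by exists (@mk_upset d W setT (fun _ _ _ => id)); exact: filterT.
- by move=> a b; rewrite le_upset => ab; exact: filterS.
- by move=> a b; exact: filterI.
- move=> /seteqP[_ /(_ bot_upset Logic.I)]; exact: filter_not_empty.
- move=> a b Uab; have [|nUa] := in_ultra_setVsetC a UU; first by left.
  by right; apply: filterS2 Uab nUa => x [].
Qed.

(** Extend the filter generated by the differences of members of [X] and [Y] to an ultrafilter on
    [W], and keep its upsets. *)
Lemma prime_filter_separation (X Y : set (upset W)) : X !=set0 -> Y !=set0 ->
  (forall a b, X a -> X b -> exists2 c, X c & (c : set W) `<=` (a : set W) `&` b) ->
  (forall a b, Y a -> Y b -> exists2 c, Y c & (a : set W) `|` b `<=` c) ->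
  (forall a b, X a -> Y b -> ~ ((a : set W) `<=` b)) ->
  exists P : pe W, X `<=` val P /\ forall b, Y b -> ~ val P b.
Proof.
move=> [a0 Xa0] [b0 Yb0] Xdir Ydir XY.
pose B (u : upset W * upset W) : set W := (u.1 : set W) `\` u.2.
have pf : ProperFilter (filter_from (X `*` Y) B).
  apply: filter_from_proper; last first.
    move=> [a b] [/= Xa Yb]; apply: contrapT => no; apply: (XY _ _ Xa Yb) => x ax.
    by apply: contrapT => bx; apply: no; exists x.
  apply: filter_from_filter; first by exists (a0, b0).
  move=> [a b] [a' b'] [/= Xa Yb] [/= Xa' Yb'].
  have [c Xc cP] := Xdir _ _ Xa Xa'; have [e Ye eP] := Ydir _ _ Yb Yb'.
  exists (c, e) => // x [/= /cP[ax a'x] nex].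
  by split; split=> // bx; apply: nex; apply: eP; [left|right].
have [U [UU BU]] := ultraFilterLemma pf.
exists (mk_pe (ultrafilter_trace UU)); split=> [a Xa|b Yb /= Ub].
  by apply: BU; exists (a, b0) => // x [].
have /BU Unb : filter_from (X `*` Y) B (~` (b : set W)).
  by exists (a0, b) => // x [].
by apply: (@filter_not_empty _ U); apply: filterS2 Ub Unb => x.
Qed.

Section Truth.
Context {L : Type} (V : L -> upset W).
Local Notation T := (truth_set V).

Lemma pe_val_up p : upclosed [set P : pe W | val P (V p)].
Proof. by move=> P Q; rewrite le_pe; exact. Qed.

Definition pe_val (p : L) : upset (pe W) := mk_upset (@pe_val_up p).

Lemma pe_truth phi P : forces pe_val P phi <-> val P (T phi).
Proof.
elim: phi P => [p| | |a IHa b IHb|a IHa b IHb|a IHa b IHb|a IHa b IHb] P /=.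
- by rewrite truth_var.
- by split=> // _; exact: pe_top.
- by split=> //; exact: pe_bot.
- rewrite IHa IHb; split=> [[Pa Pb]|Pab]; first exact: pe_meet Pa Pb _.
  by split; apply: pe_sub Pab => x [].
- rewrite IHa IHb; split=> [[]|Pab]; last exact: pe_join Pab _.
    by apply: pe_sub => x; left.
  by apply: pe_sub => x; right.
- split=> [ab|Pab Q PQ /IHa Qa]; last first.
    rewrite le_pe in PQ; apply/IHb; apply: pe_meet (PQ _ Pab) Qa _.
    by move=> x [/= + ax]; apply.
  apply: contrapT => nPab.
  (* Separate the filter generated by [P] and [T a] from [T b]. *)
  have [| | | | |Q [XQ /(_ _ erefl) nQb]] := @prime_filter_separation
      [set c : upset W | exists2 e, val P e & (e : set W) `&` T a `<=` c] [set T b].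
  + by exists (T a), (T (Top L)) => [|x []]; first exact: pe_top.
  + by exists (T b).
  + have [[_ _ Pm] _ _] := pe_prime P => c c' [e Pe ec] [e' Pe' ec'].
    exists (Order.meet c c'); last by [].
    exists (Order.meet e e'); first exact: Pm.
    by move=> x [[ex e'x] ax]; split; [apply: ec|apply: ec'].
  + by move=> _ _ -> ->; exists (T b) => // x [].
  + move=> c _ [e Pe ec] -> cb; apply: nPab; apply: pe_sub Pe => x ex v xv av.
    by apply/cb/ec; split=> //; exact: upset_up ex.
  + apply/nQb/IHb/ab; last by apply/IHa/XQ; exists (T (Top L)) => [|x []];
      first exact: pe_top.
    by rewrite le_pe => c Pc; apply: XQ; exists c => // x [].
- split=> [[Q [QP /IHa Qa nQb]]|Pab].
    rewrite le_pe in QP; apply: QP.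
    have [x ax||//] := @pe_join Q (T b) (T (Coimp a b)) _ Qa; last by move/IHb.
    have [bx|nbx] := pselect ((T b : set W) x); first by left.
    by right; exists x.
  (* Avoiding every upset outside [P] forces [Q] to lie below [P]; [T b] is avoided along with
     them. *)
  have [| | | | |Q [XQ YQ]] := @prime_filter_separation [set T a]
      [set c : upset W | exists2 e, ~ val P e & (c : set W) `<=` (T b : set W) `|` e].
  + by exists (T a).
  + by exists (T b), bot_upset => [|x]; [exact: pe_bot|left].
  + by move=> _ _ -> ->; exists (T a) => // x.
  + have [_ _ Pj] := pe_prime P => c c' [e Pe ce] [e' Pe' ce'].
    exists (Order.join c c'); last by [].
    exists (Order.join e e'); first by move=> /Pj[].
    by move=> x [/ce|/ce'] [?|?]; [left|right; left|left|right; right].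
  + move=> _ c -> [e Pe ce] ac; apply: Pe; apply: pe_sub Pab => x [v [vx av nbv]].
    by have /ac/ce[//|] := av; exact: upset_up.
  + exists Q; split.
    * rewrite le_pe => c Qc; apply: contrapT => nPc; apply: (YQ c) => //.
      by exists c => // x; right.
    * by apply/IHa/XQ.
    * move=> /IHb; apply: YQ; exists bot_upset => [|x]; [exact: pe_bot|by left].
Qed.

End Truth.

Lemma pe_valid_reflect (L : Type) (phi : form L) : valid (pe W) phi -> valid W phi.
Proof.
move=> peW V w; have pw := ultrafilter_trace (principal_filter_ultra w).
by have /pe_truth /principal_filterP := peW (pe_val V) (mk_pe pw).
Qed.

End PrimeFilters.

(** * Mapping an ultrapower onto a prime filter extension *)

Section Ultrapowers.
Context {d : Order.disp_t} {I : Type} (U : set_system I) {UU : UltraFilter U}.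
Context {F : porderType d}.

Lemma ultrapower_ae (h : I -> F) :
  exists x : ultrapower U F, U [set i | repr x i = h i].
Proof.
exists (\pi h).
by have /eqmodP/asboolP : repr (\pi_(ultrapower U F) h) = h %[mod ultrapower U F]
  by rewrite reprK.
Qed.

Lemma le_ultrapower (x y : ultrapower U F) :
  (x <= y) = U [set i | repr x i <= repr y i] :> Prop.
Proof. exact: asboolE. Qed.

End Ultrapowers.

Lemma generated_closed {d : Order.disp_t} {W : porderType d} (A : set W) :
  (forall x y, x <= y -> A x -> A y) -> (forall x y, y <= x -> A x -> A y) ->
  generated A.
Proof.
move=> up down; split=> [//|[x Ax] u xu|[x Ax] u ux].
  have Au : u \in A by apply/mem_set/(up x u xu)/set_mem.
  by exists (exist _ u Au).
have Au : u \in A by apply/mem_set/(down x u ux)/set_mem.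
by exists (exist _ u Au).
Qed.

Section Duality.
Context {d : Order.disp_t} (W F : porderType d) (V : upset W -> upset F).
Local Notation fm := (form (upset W)).
Local Notation SW := (truth_set (fun a : upset W => a)).
Local Notation SF := (truth_set V).

Context (VW : forall phi : fm,
  (forall x, (SF phi : set F) x) -> forall w, (SW phi : set W) w).

Context {I : Type} (U : set_system I) {UU : UltraFilter U}.
Context (goodU : forall p : seq {classic fm} -> set I,
  (forall s : seq {classic fm}, U (p s)) -> exists g : I -> seq {classic fm},
    forall s : seq {classic fm}, U [set i | {subset s <= g i} /\ p (g i) i]).

(** Saturation: the type of [Q] is realized within the internal set given by [R], which expresses
    the relation to a parameter. Conjunctions and disjunctions reduce a finite part of the type to
    one formula in [Q] and one outside. *)
Lemma realize (R : I -> set F) (Q : pe W) :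
  (forall phi psi, val Q (SW phi) -> ~ val Q (SW psi) ->
     U [set i | exists y, [/\ R i y, (SF phi : set F) y & ~ (SF psi : set F) y]]) ->
  exists x : ultrapower U F, U [set i | R i (repr x i)] /\
    forall phi, U [set i | (SF phi : set F) (repr x i)] <-> val Q (SW phi).
Proof.
move=> finsat.
pose ok (s : seq {classic fm}) i (y : F) := R i y /\
  {in s, forall phi, (SF phi : set F) y <-> val Q (SW phi)}.
have Uok s : U [set i | exists y, ok s i y].
  have [phi [psi [Qphi Qpsi dec]]] : exists phi psi : fm,
      [/\ val Q (SW phi), ~ val Q (SW psi) &
        forall y, (SF phi : set F) y -> ~ (SF psi : set F) y ->
          {in s, forall chi, (SF chi : set F) y <-> val Q (SW chi)}].
    elim: s => [|chi s [phi [psi [Qphi Qpsi dec]]]].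
      by exists (Top _), (Bot _); split=> //; [exact: pe_top|exact: pe_bot].
    have [Qchi|Qchi] := pselect (val Q (SW chi)).
      exists (And chi phi), psi; split=> //; first exact: pe_meet Qchi Qphi _.
      move=> y [ychi yphi] ypsi theta; rewrite inE => /orP[/eqP->//|].
      exact: dec.
    exists phi, (Or chi psi); split=> //.
      by move=> /(@pe_join _ _ Q (SW chi) (SW psi))[].
    move=> y yphi ychipsi theta; rewrite inE => /orP[/eqP->|].
      by split=> // ychi; case: ychipsi; left.
    by apply: dec => // ypsi; apply: ychipsi; right.
  apply: filterS (finsat _ _ Qphi Qpsi) => i [y [Ry yphi ypsi]].
  by exists y; split=> //; exact: dec.
have [_ [y0 _]] := filter_ex (Uok [::]).
have [g gP] := goodU Uok.
(* [h i] realizes the part [g i] where possible, with default [y0]; almost everywhere [g i] is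
   realizable and includes any given finite list. *)
have /choice[h hP] i : exists y, (exists y', ok (g i) i y') -> ok (g i) i y.
  have [[y oky]|no] := pselect (exists y', ok (g i) i y'); first by exists y.
  by exists y0.
have [x xh] := ultrapower_ae (U := U) h.
exists x; split.
  apply: filterS2 xh (gP [::]) => i /= -> [_ /hP[]]; exact.
have dec phi : U [set i | (SF phi : set F) (repr x i) <-> val Q (SW phi)].
  apply: filterS2 xh (gP [:: phi]) => i /= -> [sub /hP[_]]; apply.
  by apply: sub; rewrite inE.
move=> phi; split=> [Uphi|Qphi].
  by have [i [/= [+ _] yphi]] := filter_ex (filterI (dec phi) Uphi); exact.
by apply: filterS (dec phi) => i /= [_]; exact.
Qed.

(** By the theorem of Los this is truth at [x] in the ultrapower of the model; as a definition it
    needs no valuation on the ultrapower. *)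
Definition sat (x : ultrapower U F) (phi : fm) : Prop :=
  U [set i | (SF phi : set F) (repr x i)].

Lemma sat_bot x : ~ sat x (Bot _).
Proof. by move=> /filter_ex[]. Qed.

Lemma satN x phi : ~ sat x phi -> U [set i | ~ (SF phi : set F) (repr x i)].
Proof. by case: (in_ultra_setVsetC [set i | (SF phi : set F) (repr x i)] UU). Qed.

Definition good_points : set (ultrapower U F) :=
  [set x | forall phi psi, (SW phi : set W) `<=` SW psi -> sat x phi -> sat x psi].

(** If the truth set of [phi] is included in that of [psi], then on [W] the formula [Imp phi psi]
    holds everywhere, which gives closure upwards, and [Coimp phi psi] nowhere, which gives closure
    downwards. *)
Lemma good_points_generated : generated good_points.
Proof.
apply: generated_closed => x y; rewrite le_ultrapower => xy Gx phi psi sub.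
  move=> yphi.
  have ximp : sat x (Imp phi psi).
    apply: (Gx (Top _)); last exact: filterT.
    by move=> w _ v _ /sub.
  by apply: filterS3 xy ximp yphi => i xyi imp yi; exact: imp.
move=> yphi; apply: contrapT => /satN ypsi; apply: (@sat_bot x).
apply: (Gx (Coimp phi psi)); first by move=> w [v [_ /sub]].
by apply: filterS3 xy yphi ypsi => i yxi yi nyi; exists (repr y i).
Qed.

Lemma good_points_sat x phi : good_points x ->
  sat x phi <-> sat x (Var (SW phi)).
Proof. by move=> Gx; split; apply: Gx. Qed.

Lemma good_points_prime x : good_points x ->
  prime_filter [set a : upset W | sat x (Var a)].
Proof.
move=> Gx; split; first split.
- have xT : sat x (Top _) by exact: filterT.
  by exists (SW (Top _)); move: xT => /(good_points_sat _ Gx).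
- by move=> a b; rewrite le_upset => ab; exact: Gx.
- move=> a b xa xb; apply: (Gx (And (Var a) (Var b))); first by [].
  exact: filterI.
- move=> /seteqP[_ /(_ (SW (Bot _)) Logic.I)].
  by move=> /(good_points_sat (Bot _) Gx)/(@sat_bot x).
- move=> a b xjoin; have xab : sat x (Or (Var a) (Var b)).
    by apply: Gx xjoin.
  have [|/satN nxa] := pselect (sat x (Var a)); first by left.
  by right; apply: filterS2 xab nxa => i [].
Qed.

Definition to_pe (x : subframe good_points) : pe W :=
  mk_pe (good_points_prime (set_mem (valP x))).

Lemma to_pe_realized (x : ultrapower U F) (Q : pe W) :
  (forall phi, sat x phi <-> val Q (SW phi)) ->
  exists2 u : subframe good_points, val u = x & to_pe u = Q.
Proof.
move=> xQ; have Gx : good_points x.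
  by move=> phi psi sub /xQ Qphi; apply/xQ; exact: pe_sub Qphi.
exists (exist _ x (mem_set Gx)) => //; apply/val_inj/seteqP; split=> a /=.
  by move=> /xQ; rewrite truth_var.
by move=> Qa; apply/xQ; rewrite truth_var.
Qed.

(** The back conditions come from [realize]: for [phi] in [Q] and [psi] outside, failure of
    [Imp phi psi] at [x] gives a witness above, truth of [Coimp phi psi] one below. *)
Lemma to_pe_bounded_morphism : bounded_morphism to_pe.
Proof.
have toE x phi : val (to_pe x) (SW phi) <-> sat (val x) phi.
  by rewrite (good_points_sat _ (set_mem (valP x))).
split.
- move=> x y; rewrite -Order.le_val le_ultrapower le_pe => xy a xa.
  by apply: filterS2 xy xa => i; exact: upset_up.
- move=> x Q; rewrite le_pe => xQ.
  have [phi psi Qphi Qpsi|y [xy /to_pe_realized[u uy uQ]]] :=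
      @realize (fun i => [set y | repr (val x) i <= y]) Q.
    have /satN : ~ sat (val x) (Imp phi psi).
      by move=> /toE/xQ Qimp; apply: Qpsi; apply: pe_meet Qimp Qphi _ => w []; exact.
    apply: filterS => i /= /existsNP[y /not_implyP[xy /not_implyP[yphi ypsi]]].
    by exists y.
  by exists u => //; rewrite -Order.le_val le_ultrapower uy.
- move=> x Q; rewrite le_pe => Qx.
  have [phi psi Qphi Qpsi|y [xy /to_pe_realized[u uy uQ]]] :=
      @realize (fun i => [set y | y <= repr (val x) i]) Q.
    have : sat (val x) (Coimp phi psi).
      apply/toE/Qx.
      have [w wphi|//|//] :=
        @pe_join _ _ Q (SW psi) (SW (Coimp phi psi)) _ Qphi.
      have [wpsi|npsi] := pselect ((SW psi : set W) w); [by left|right].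
      by exists w.
    by apply: filterS => i [y [xy yphi ypsi]]; exists y.
  by exists u => //; rewrite -Order.le_val le_ultrapower uy.
Qed.

Lemma to_pe_surj (Q : pe W) : exists x, to_pe x = Q.
Proof.
have [phi psi Qphi Qpsi|x [_ /to_pe_realized[u _ <-]]] := @realize (fun=> setT) Q.
  (* Without a witness, [Imp phi psi] would hold throughout [F], hence on [W], and [Q] would contain
     [psi]. *)
  apply: filterE => i; apply: contrapT => no; apply: Qpsi; apply: pe_sub Qphi => w.
  have imp x : (SF (Imp phi psi) : set F) x.
    by move=> v _ vphi; apply: contrapT => vpsi; apply: no; exists v.
  exact: (@VW (Imp phi psi) imp w w (lexx w)).
by exists u.
Qed.

End Duality.

(** * Refuting frames and the definability theorem *)

Section Renaming.
Context {A B : Type}.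

Fixpoint form_map (s : A -> B) (phi : form A) : form B :=
  match phi with
  | Var p => Var (s p)
  | Top => Top B
  | Bot => Bot B
  | And a b => And (form_map s a) (form_map s b)
  | Or a b => Or (form_map s a) (form_map s b)
  | Imp a b => Imp (form_map s a) (form_map s b)
  | Coimp a b => Coimp (form_map s a) (form_map s b)
  end.

Fixpoint letters (phi : form A) : seq A :=
  match phi with
  | Var p => [:: p]
  | Top | Bot => [::]
  | And a b | Or a b | Imp a b | Coimp a b => letters a ++ letters b
  end.

End Renaming.

Lemma forces_form_map (A : eqType) (B : Type) (d : Order.disp_t) (W : porderType d)
    (s : A -> B) (V : A -> upset W) (V' : B -> upset W) phi :
  {in letters phi, forall p, V' (s p) = V p} ->
  forall w, forces V' w (form_map s phi) <-> forces V w phi.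
Proof.
elim: phi => //= [p VV' w|a IHa b IHb VV'|a IHa b IHb VV'|a IHa b IHb VV'
                 |a IHa b IHb VV'].
  by rewrite VV' // inE.
all: have {}IHa : forall w, forces V' w (form_map s a) <-> forces V w a
  by apply: IHa => p pa; apply: VV'; rewrite mem_cat pa.
all: have {}IHb : forall w, forces V' w (form_map s b) <-> forces V w b
  by apply: IHb => p pb; apply: VV'; rewrite mem_cat pb orbT.
all: move=> w.
- by rewrite IHa IHb.
- by rewrite IHa IHb.
- by split=> ab v wv /IHa/(ab _ wv)/IHb.
- by split=> -[v [vw /IHa va vb]]; exists v; split=> // /IHb.
Qed.

Lemma infinite_inj (L : Type) : infinite_set [set: L] ->
  exists e : nat -> L, injective e.
Proof.
move=> /infiniteP/card_leP[e]; have inT (n : nat) : n \in [set: nat] by rewrite inE.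
exists (fun n => val (e (exist _ n (inT n)))) => m n /val_inj/inj.
by move=> /(_ (mem_set Logic.I) (mem_set Logic.I))[].
Qed.

Lemma infinite_rename (A : eqType) (a0 : A) (L : Type) (s : seq A) :
  infinite_set [set: L] ->
  exists (r : A -> L) (r' : L -> A), {in s, cancel r r'}.
Proof.
move=> /infinite_inj[e einj].
have /choice[n nP] l : exists n, forall n', e n' = l -> n = n'.
  have [[n nl]|no] := pselect (exists n, e n = l).
    by exists n => n' n'l; apply: einj; rewrite nl n'l.
  by exists 0%N => n' n'l; case: no; exists n'.
exists (fun a => e (index a s)), (fun l => nth a0 s (n l)) => a sa.
by rewrite (nP _ _ erefl) nth_index.
Qed.

(** Rename the finitely many letters of [phi] into [L]: the result is valid on [K], hence on [W],
    and a valuation undoing the renaming returns [phi]. The given letter is the default of the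
    inverse renaming. *)
Lemma form_valid_instance (L : Type) (d : Order.disp_t) (K : porderType d -> Prop)
    (A : eqType) (W : porderType d) (V : A -> upset W) (phi : form A) :
  A -> infinite_set [set: L] ->
  (forall psi : form L, (forall F, K F -> valid F psi) -> valid W psi) ->
  (forall F, K F -> valid F phi) -> forall w, forces V w phi.
Proof.
move=> a0 Linf WL Kphi w.
have [r [r' rK]] := infinite_rename a0 (letters phi) Linf.
have Wpsi : valid W (form_map r phi).
  apply: WL => F KF V' x.
  by apply/(forces_form_map (V := fun p => V' (r p))) => //; exact: Kphi.
apply/(@forces_form_map _ _ _ _ r _ (fun l => V (r' l))); last exact: Wpsi.
by move=> p /rK ->.
Qed.

(** One refuting model is chosen for each formula refuted on [K]; indexing by formulas rather than
    by models keeps the index type small. *)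
Lemma refuting_frame (A : Type) (d : Order.disp_t) (K : porderType d -> Prop) :
  closed_disjoint_unions K -> exists (F : porderType d) (V : A -> upset F),
    K F /\ forall phi, (forall x, forces V x phi) -> forall F', K F' -> valid F' phi.
Proof.
move=> Kdu.
pose refutes phi (u : {F : porderType d & ((A -> upset F) * F)%type}) :=
  K (tag u) /\ ~ forces (tagged u).1 (tagged u).2 phi.
have /choice[u uP] (j : {phi : form A | exists u, refutes phi u}) :
  exists u, refutes (sval j) u by case: j.
pose V a : set (disjoint_union (fun j => tag (u j))) :=
  [set x | ((tagged (u (tag x))).1 a : set (tag (u (tag x)))) (tagged x)].
have upV a : upclosed (V a).
  by move=> x y /asboolP[j {}x {}y xy]; exact: upset_up.
exists (disjoint_union (fun j => tag (u j))), (fun a => mk_upset (upV a)); split.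
  by apply: Kdu => j; have [] := uP j.
move=> phi Fphi F' KF' V' w; apply: contrapT => nphi.
have ref : exists u, refutes phi u by exists (existT _ F' (V', w)).
have [_] := uP (exist _ phi ref); apply.
apply/(forces_bounded_morphism (V' := fun a => mk_upset (upV a))
  (disjoint_union_inj (fun j => tag (u j)) (exist _ phi ref))) => //.
Qed.

Theorem theorem29 (L : Type) (d : Order.disp_t) (K : porderType d -> Prop)
    (closedU : closed_ultrapowers K) :
  (definable L K ->
     [/\ closed_generated_subframes K, closed_bounded_morphic_images K,
         closed_disjoint_unions K & reflects_pe K]) /\
  (infinite_set [set: L] ->
     [/\ closed_generated_subframes K, closed_bounded_morphic_images K,
         closed_disjoint_unions K & reflects_pe K] ->
     definable L K).

Proof.
split=> [[Theta KTheta]|Linf [Kgen Kimg Kdu Kpe]].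
  split.
  - move=> W A /KTheta Wphi gA; apply/KTheta => phi Tphi.
    exact: valid_generated gA (Wphi _ Tphi).
  - move=> W W' f /KTheta Wphi bf fsurj; apply/KTheta => phi Tphi.
    exact: valid_image bf fsurj (Wphi _ Tphi).
  - move=> I W KW; apply/KTheta => phi Tphi.
    by apply: valid_disjoint_union => i; have /KTheta := KW i; exact.
  - move=> W /KTheta Wphi; apply/KTheta => phi Tphi.
    exact: pe_valid_reflect (Wphi _ Tphi).
exists [set phi | forall F, K F -> valid F phi] => W.
split=> [KW phi|WK]; first exact.
have [F [V [KF Fphi]]] := refuting_frame (upset W) Kdu.
have [U [UU goodU]] := good_ultrafilter {classic form (upset W)}.
have VW phi : (forall x, forces V x phi) -> forall w, forces (fun a : upset W => a) w phi.
  move=> /Fphi; apply: form_valid_instance WK => //; exact: bot_upset.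
apply: Kpe; apply: (Kimg _ _ (@to_pe _ W F V _ U UU)).
- by apply: Kgen; [exact: closedU|exact: good_points_generated].
- exact: to_pe_bounded_morphism.
- exact: to_pe_surj.
Qed.
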